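(* Let $Z_1,Z_2,\ldots$ be i.i.d. bivariate Gaussian random vectors $Z_i=(Z_i^{(1)},Z_i^{(2)})$ whose components are standard normal (mean $0$, variance $1$) with correlation coefficient $\rho\in[-1,1]$. Let $\bar Z_n=(\max_{1\le i\le n}Z_i^{(1)},\max_{1\le i\le n}Z_i^{(2)})$. Then for any $a_n\gg\sqrt{\log n}$, and for $u=(u^{(1)},u^{(2)})$ with $u^{(1)},u^{(2)}\in(0,\infty)$ and $u^{(2)}\le u^{(1)}$, $$\lim_{n\to\infty}\frac1{a_n^2}\log\mathbb{P}(\bar Z_n>a_nu)=-I(u),$$ where $$I(u)=\begin{cases}\tfrac12(u^{(1)})^2&\text{when }u^{(2)}\le\rho u^{(1)},\\ \tfrac12\min\Big\{\|u\|_2^2,\ \dfrac{(u^{(1)})^2-2\rho u^{(1)}u^{(2)}+(u^{(2)})^2}{1-\rho^2}\Big\}&\text{otherwise.}\end{cases}$$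
   Context: Vector inequalities are component-wise: $x>y$ means $x^{(j)}>y^{(j)}$ for $j=1,2$. $\|u\|_2^2=(u^{(1)})^2+(u^{(2)})^2$. The notation $a_n\gg\sqrt{\log n}$ means that $(a_n)$ is a sequence of positive reals with $a_n/\sqrt{\log n}\to\infty$ as $n\to\infty$. *)

(* Defs.v *)
From HB Require Import structures.
From mathcomp Require Import all_boot all_order all_algebra.
From mathcomp Require Import all_classical all_reals all_analysis.

Set Implicit Arguments.
Unset Strict Implicit.
Unset Printing Implicit Defensive.

Import Order.TTheory GRing.Theory Num.Theory.
Import numFieldNormedType.Exports.

Local Open Scope classical_set_scope.
Local Open Scope ring_scope.

Section Families.
Context d d' (T : measurableType d) (T' : measurableType d') (R : realType).
Variables (P : probability T R) (X : nat -> {RV P >-> T'}).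

Definition mutually_independent :=
  forall (J : seq nat) (B : nat -> set T'), uniq J ->
    (forall j, measurable (B j)) ->
    P (\big[setI/setT]_(j <- J) (X j @^-1` B j)) =
    (\prod_(j <- J) P (X j @^-1` B j))%E.

Definition identically_distributed :=
  forall (i j : nat) (B : set T'), measurable B ->
    distribution P (X i) B = distribution P (X j) B.

Definition iid := mutually_independent /\ identically_distributed.

End Families.

Section Gaussian.
Context d (T : measurableType d) (R : realType) (P : probability T R).

(* The normal law with mean m and standard deviation s, degenerate case
   included: normal_prob m 0 is the uniform law on [0, 1], not a point mass. *)
Definition gaussian_law (m s : R) (B : set R) : \bar R :=
  if s == 0 then \d_m B else normal_prob m s B.

Definition has_gaussian_law (X : T -> R) (m s : R) :=
  forall B : set R, measurable B -> P (X @^-1` B) = gaussian_law m s B.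

(* Jointly Gaussian: every linear combination of the components is Gaussian.
   This covers singular covariance matrices, i.e. correlation 1 or -1. *)
Definition bivariate_gaussian (Z : T -> R * R) :=
  forall b c : R, exists m s : R,
    0 <= s /\ has_gaussian_law (fun w => b * (Z w).1 + c * (Z w).2) m s.

Definition correlation (X Y : T -> R) : R :=
  fine (covariance P X Y) /
  (Num.sqrt (fine ('V_P[X])%E) * Num.sqrt (fine ('V_P[Y])%E)).

Definition std_bivariate_gaussian (rho : R) (Z : T -> R * R) :=
  [/\ bivariate_gaussian Z,
      has_gaussian_law (fun w => (Z w).1) 0 1,
      has_gaussian_law (fun w => (Z w).2) 0 1 &
      correlation (fun w => (Z w).1) (fun w => (Z w).2) = rho].

End Gaussian.

Section Extremes.
Context (T : Type) (R : realType).

(* Componentwise maximum of Z 0, ..., Z n.-1. The initial value Z 0 w is one of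
   the terms as soon as 0 < n. *)
Definition Zbar (Z : nat -> T -> R * R) (n : nat) (w : T) : R * R :=
  (\big[Num.max/(Z 0%N w).1]_(i < n) (Z i w).1,
   \big[Num.max/(Z 0%N w).2]_(i < n) (Z i w).2).

Definition vec_gt (x y : R * R) := (y.1 < x.1) /\ (y.2 < x.2).

Definition vec_scale (a : R) (x : R * R) : R * R := (a * x.1, a * x.2).

Definition sqnorm2 (u : R * R) : R := u.1 ^+ 2 + u.2 ^+ 2.

(* Extended-real valued because of rho = -1, where the quotient by
   1 - rho ^ 2 = 0 has to be read as +oo: in \bar R, 0^-1 = +oo, whereas
   x / 0 = 0 in R. When rho = 1 and u.2 <= u.1, the first case applies. *)
Definition rate (rho : R) (u : R * R) : \bar R :=
  if u.2 <= rho * u.1 then (2^-1 * u.1 ^+ 2)%:E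
  else ((2^-1)%:E *
    Order.min (sqnorm2 u)%:E
      ((u.1 ^+ 2 - 2 * rho * u.1 * u.2 + u.2 ^+ 2)%:E
       / (1 - rho ^+ 2)%:E))%E.

(* a_n >> sqrt (log n) *)
Definition dominates_sqrt_log (a : nat -> R) :=
  (forall n : nat, (0 < n)%N -> 0 < a n) /\
  (a n / Num.sqrt (ln n%:R) @[n --> \oo] --> +oo).

End Extremes.

(* Main.v *)
Require Import Defs.
From HB Require Import structures.
From mathcomp Require Import all_boot all_order all_algebra.
From mathcomp Require Import all_classical all_reals all_analysis.
From mathcomp Require Import measurable_realfun ring lra.

Set Implicit Arguments.
Unset Strict Implicit.
Unset Printing Implicit Defensive.

Import Order.TTheory GRing.Theory Num.Theory.
Import numFieldNormedType.Exports.

Local Open Scope classical_set_scope.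
Local Open Scope ring_scope.

(* The event is the union over i, j of {X_i > a u1, Y_j > a u2}, so
   its probability lies between the largest of these n^2 probabilities and n^2
   times it, and log n is negligible against a_n^2. For i <> j independence gives
   the exponent |u|^2 / 2. For i = j only the one-dimensional laws of the linear
   combinations of X and Y are needed: a half-plane containing the quadrant bounds
   its probability from above; for the lower bound, the half-plane {L > a l}
   tangent to the Gaussian level ellipse slightly beyond the optimal point is
   exhausted, up to events of strictly larger exponent, by the quadrant. Each of
   the two leftover pieces {L > a l, M <= a m} lies in a half-plane
   {L - t M > a (l - t m)} farther from the origin. *)

(** * Integrals against normal densities and bounds on normal tails *)

Section normal_integrals.
Context {R : realType}.
Implicit Types (m s x : R) (h : R -> R).
Local Notation mu := (@lebesgue_measure R).

(** The Radon-Nikodym derivative of [normal_prob m s] and [normal_pdf m s] have the same integral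
    over every measurable set, hence agree almost everywhere. *)
Lemma ge0_integral_normal_prob m s h :
  measurable_fun [set: R] h -> (forall x, 0 <= h x) ->
  (\int[normal_prob m s]_x (h x)%:E = \int[mu]_x (h x * normal_pdf m s x)%:E)%E.
Proof.
move=> mh h0.
have dom := normal_prob_dominates m s.
have mEh := (measurable_EFinP _ _).2 mh.
rewrite -(@Radon_Nikodym_SigmaFinite.change_of_variables _ _ _
  (normal_prob m s) mu dom (EFin \o h))//.
apply: ae_eq_integral => //.
- apply: emeasurable_funM => //; apply: measurable_int.
  exact: Radon_Nikodym_SigmaFinite.f_integrable.
- apply/measurable_EFinP/measurable_funM => //; exact: measurable_normal_pdf.
- under [X in ae_eq _ _ _ X]eq_fun do rewrite EFinM.
  apply: ae_eqe_mul2l => /=.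
  apply: integral_ae_eq => //.
  + exact: Radon_Nikodym_SigmaFinite.f_integrable.
  + by apply/measurable_EFinP; exact: measurable_normal_pdf.
  + by move=> E _ mE; rewrite -Radon_Nikodym_SigmaFinite.f_integral.
Qed.

(** Reflection exchanges the two closed half-lines at 0, and their common point is Lebesgue-null. *)
Lemma ge0_integral_opp h : continuous h -> (forall x, 0 <= h x) ->
  (\int[mu]_x (h x)%:E = \int[mu]_x (h (- x))%:E)%E.
Proof.
move=> ch h0.
have half (f : R -> R) : continuous f -> (forall x, 0 <= f x) ->
    (\int[mu]_(x in `]-oo, 0%R]) (f x)%:E =
     \int[mu]_(x in `[0%R, +oo[) (f (- x))%:E)%E.
  move=> cf f0; rewrite -[in LHS]oppr0 ge0_integration_by_substitutionNy//.
  exact: continuous_subspaceT.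
have split (f : R -> R) : continuous f -> (forall x, 0 <= f x) ->
    (\int[mu]_x (f x)%:E = \int[mu]_(x in `]-oo, 0%R]) (f x)%:E +
      \int[mu]_(x in `[0%R, +oo[) (f x)%:E)%E.
  move=> cf f0.
  have mf : measurable_fun [set: R] f by exact: continuous_measurable_fun.
  rewrite -(@integral_itv_obnd_cbnd _ 0%R)//; last first.
    exact/measurable_EFinP/measurable_funTS.
  rewrite -(ge0_integral_setU mu)//=.
  - by rewrite -setCitvl setUv.
  - by apply/measurable_EFinP; apply: measurable_funTS.
  - by move=> x _; rewrite lee_fin.
  - rewrite disj_set2E; apply/eqP; rewrite -subset0 => x []/= /[!in_itv]/=.
    by rewrite andbT ltNge => -> /negP.
have cN : continuous (fun x : R => h (- x)).
  by move=> x; apply: (@continuous_comp _ _ _ -%R h);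
    [exact: opp_continuous | exact: ch].
rewrite (split h)// (split (fun x => h (- x)))// (half h)// (half (fun x => h (- x)))//.
rewrite addeC; congr (_ + _)%E.
apply: eq_integral => x _; congr (h _)%:E; exact/esym/opprK.
Qed.

(** The factor [s] on the left is the Jacobian of [m + s * x]. The density depends on [s] only
    through [s ^+ 2], so its peak contributes the inverse of the absolute value and a sign is left
    over. *)
Lemma normal_pdf_affine m s x : s != 0 ->
  s * normal_pdf m s (m + s * x) = Num.sg s * normal_pdf 0 1 x.
Proof.
move=> s0; rewrite !normal_pdfE ?oner_eq0//.
rewrite /normal_peak /normal_fun !expr1n mul1r.
rewrite -mulrnAr sqrtrM ?sqr_ge0// sqrtr_sqr invfM.
have -> : - (m + s * x - m) ^+ 2 / (s ^+ 2 *+ 2) = - (x - 0) ^+ 2 / (1 *+ 2).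
  rewrite addrAC subrr add0r subr0 exprMn -[_ *+ 2]mulr_natr -mulrN -mulf_div.
  by rewrite divff ?mul1r ?sqrf_eq0.
rewrite !mulrA; congr (_ * _ * _).
by rewrite {1}[s]numEsg -mulrA divff ?mulr1// normr_eq0.
Qed.

Lemma ge0_integral_normal_affine m s h : 0 < s ->
  continuous h -> (forall x, 0 <= h x) ->
  (\int[normal_prob m s]_x (h x)%:E =
   \int[mu]_x (h (m + s * x) * normal_pdf 0 1 x)%:E)%E.
Proof.
move=> s0 ch h0.
rewrite (ge0_integral_normal_prob _ _ (continuous_measurable_fun ch) h0).
pose F x := m + s * x.
have dF x : is_derive x 1 F s.
  rewrite /F; apply: is_derive_eq.
  by rewrite add0r mul1r [LHS]mulr1.
have F'E : derive1 F = cst s by apply/funext => x; rewrite derive1E derive_val.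
rewrite (@increasing_ge0_integration_by_substitutionT _ F).
- apply: eq_integral => x _ /=; rewrite F'E /= !fctE /=; congr EFin.
  by rewrite -mulrA (mulrC _ s) normal_pdf_affine ?gt_eqF// gtr0_sg// mul1r.
- by move=> x y xy; rewrite /F ltrD2l ltr_pM2l.
- by rewrite F'E => x; exact: cst_continuous.
- by rewrite F'E; exact: is_cvg_cst.
- by rewrite F'E; exact: is_cvg_cst.
- by move=> x; exact: ex_derive.
- apply/cvgrNyPle => A.
  apply: filterS (nbhs_ninfty_le (num_real ((A - m) / s))) => x xA.
  by rewrite /F -lerBrDl mulrC -ler_pdivlMr.
- apply/cvgryPge => A.
  apply: filterS (nbhs_pinfty_ge (num_real ((A - m) / s))) => x xA.
  by rewrite /F -lerBlDl mulrC -ler_pdivrMr.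
- by move=> x; apply: continuousM; [exact: ch|apply: continuous_normal_pdf; rewrite gt_eqF].
- by move=> x; rewrite mulr_ge0// normal_pdf_ge0.
Qed.

Definition normal_second_moment : \bar R :=
  (\int[mu]_x (x ^+ 2 * normal_pdf 0 1 x)%:E)%E.

(** Half of the Gaussian exponent absorbs the square: [x ^+ 2 * expR (- (x ^+ 2 / 4)) <= 4]. What
    remains is a multiple of the density with variance 2. *)
Lemma normal_second_moment_lty : (normal_second_moment < +oo)%E.
Proof.
rewrite /normal_second_moment.
set s := Num.sqrt 2 : R.
have s2 : s ^+ 2 = 2 by rewrite sqr_sqrtr.
have s0 : 0 < s by rewrite sqrtr_gt0.
set K : R := 4 * normal_peak 1 / normal_peak s.
have K0 : 0 <= K by rewrite !mulr_ge0 ?invr_ge0 ?normal_peak_ge0.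
have key x : x ^+ 2 * normal_fun 0 1 x <= 4 * normal_fun 0 s x.
  rewrite /normal_fun s2.
  have -> : - (x - 0) ^+ 2 / (1 ^+ 2 *+ 2) = - (x ^+ 2 / 4) - x ^+ 2 / 4 :> R by field.
  have -> : - (x - 0) ^+ 2 / (2 *+ 2) = - (x ^+ 2 / 4) :> R by field.
  rewrite expRD mulrA ler_wpM2r ?expR_ge0// expRN ler_pdivrMr ?expR_gt0//.
  have := expR_ge1Dx (x ^+ 2 / 4); lra.
have le x : x ^+ 2 * normal_pdf 0 1 x <= K * normal_pdf 0 s x.
  rewrite !normal_pdfE ?oner_eq0// ?gt_eqF//.
  rewrite /K [leRHS]mulrA divfK ?gt_eqF ?normal_peak_gt0 ?gt_eqF//.
  by rewrite mulrCA [4 * _]mulrC -[leRHS]mulrA ler_wpM2l ?normal_peak_ge0.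
have mpdf t := @measurable_normal_pdf R 0 t.
have m2 : measurable_fun [set: R] (fun x : R => x ^+ 2).
  by apply: measurable_funX.
apply: (@le_lt_trans _ _ (\int[mu]_x (K * normal_pdf 0 s x)%:E)%E).
  apply: ge0_le_integral => //.
  - by move=> x _; rewrite lee_fin mulr_ge0 ?sqr_ge0 ?normal_pdf_ge0.
  - by apply/measurable_EFinP; apply: measurable_funM; [exact: m2|exact: mpdf].
  - by apply/measurable_EFinP; apply: measurable_funM => //; exact: mpdf.
  - by move=> x _; rewrite lee_fin.
under eq_integral do rewrite EFinM.
rewrite ge0_integralZl//=.
- by rewrite integral_normal_pdf mule1 ltry.
- by apply/measurable_EFinP; exact: mpdf.
- by move=> x _; rewrite lee_fin normal_pdf_ge0.
Qed.

(** The unit interval just after [y] suffices: the density decreases on it, so it is at least its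
    value at [y + 1]. *)
Lemma normal_prob01_tail_ge y : 0 <= y ->
  ((normal_peak 1 * expR (- (y + 1) ^+ 2 / 2))%:E <=
   normal_prob (0 : R)%R 1%R [set x | (y < x)%R])%E.
Proof.
move=> y0; rewrite -set_itvoy.
apply: (@le_trans _ _ (normal_prob 0%R 1%R `]y, (y + 1)%R[)); last first.
  apply: le_measure; rewrite ?inE//.
  by move=> x /=; rewrite !in_itv/= => /andP[->].
rewrite /normal_prob.
apply: (@le_trans _ _ (\int[mu]_(x in `]y, (y + 1)%R[)
  (normal_peak 1 * expR (- (y + 1) ^+ 2 / 2))%:E)%E).
  rewrite integral_cst//= lebesgue_measure_itv/= lte_fin ltrDl ltr01.
  by rewrite -EFinD addrAC subrr add0r mule1.
apply: ge0_le_integral => //.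
- by move=> x _; rewrite lee_fin mulr_ge0 ?normal_peak_ge0 ?expR_ge0.
- by apply/measurable_EFinP; apply: measurable_funTS; exact: measurable_normal_pdf.
- move=> x /=; rewrite in_itv/= => /andP[yx xy]; rewrite lee_fin.
  rewrite normal_pdfE ?oner_eq0// ler_wpM2l ?normal_peak_ge0// ler_expR.
  rewrite expr1n !mulNr lerN2 ler_pM2r ?invr_gt0//.
  by rewrite subr0 ler_sqr ?nnegrE; lra.
Qed.

(** For [0 <= y < x], [x ^+ 2 >= y ^+ 2 + (x - y) ^+ 2]; so beyond [y] the density centred at 0 is
    at most [c] times the density centred at [y], which has total mass 1. *)
Lemma normal_prob_tail_le (s y : R) : 0 < s -> 0 <= y ->
  (normal_prob 0%R s [set x | (y < x)%R] <=
   (expR (- y ^+ 2 / (s ^+ 2 *+ 2)))%:E)%E.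
Proof.
move=> s0 y0; rewrite -set_itvoy /normal_prob.
set c := expR _.
have mpdf t := @measurable_normal_pdf R t s.
have c0 : 0 <= c by exact: expR_ge0.
apply: (@le_trans _ _ (\int[mu]_(x in `]y, +oo[) (c * normal_pdf y s x)%:E)%E).
  apply: ge0_le_integral => //.
  - by move=> x _; rewrite lee_fin normal_pdf_ge0.
  - by apply/measurable_EFinP; apply: measurable_funTS; exact: mpdf.
  - apply/measurable_EFinP; apply: measurable_funTS.
    by apply: measurable_funM => //; exact: mpdf.
  - move=> x /=; rewrite in_itv/= andbT => yx; rewrite lee_fin.
    rewrite !normal_pdfE ?gt_eqF// mulrCA ler_wpM2l ?normal_peak_ge0//.
    rewrite /c -expRD ler_expR -mulrDl ler_pM2r ?invr_gt0 ?pmulrn_lgt0 ?exprn_gt0//.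
    nra.
under eq_integral do rewrite EFinM.
rewrite ge0_integralZl//=.
- rewrite -[leRHS]mule1 lee_wpmul2l ?lee_fin// -(integral_normal_pdf y s).
  apply: ge0_subset_integral => //.
  + by apply/measurable_EFinP; exact: mpdf.
  + by move=> x _; rewrite lee_fin normal_pdf_ge0.
- by apply/measurable_EFinP; apply: measurable_funTS; exact: mpdf.
- by move=> x _; rewrite lee_fin normal_pdf_ge0.
Qed.

(** The square is at least 1 on the half-line beyond 1, which has positive mass by the lower tail
    bound. *)
Lemma normal_second_moment_gt0 : (0 < normal_second_moment)%E.
Proof.
rewrite /normal_second_moment.
have m2 : measurable_fun [set: R] (fun x : R => x ^+ 2).
  by apply: measurable_funX.
rewrite -(@ge0_integral_normal_prob 0 1 (fun x => x ^+ 2))//; last first.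
  by move=> x; exact: sqr_ge0.
apply: (@lt_le_trans _ _ (normal_prob (0 : R)%R 1%R [set x : R | (1 < x)%R])).
  apply: lt_le_trans (normal_prob01_tail_ge ler01).
  by rewrite lte_fin mulr_gt0 ?expR_gt0 ?normal_peak_gt0 ?oner_eq0.
have mA : measurable [set x : R | (1 < x)%R] by rewrite -set_itvoy.
rewrite -[leLHS]mul1e -(integral_cst (normal_prob 0 1) mA 1).
apply: (@le_trans _ _ (\int[normal_prob (0 : R)%R 1%R]_(x in
  [set x : R | (1 < x)%R]) (x ^+ 2)%:E)%E).
  apply: ge0_le_integral => //.
  - by apply/measurable_EFinP; apply: measurable_funTS; exact: m2.
  - by move=> x /= x1; rewrite lee_fin; nra.
apply: ge0_subset_integral => //.
- by apply/measurable_EFinP; exact: m2.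
- by move=> x _; rewrite lee_fin sqr_ge0.
Qed.

End normal_integrals.

(** * Moments of Gaussian laws and the law of a linear combination *)

Section gaussian_laws.
Context d (T : measurableType d) (R : realType) (P : probability T R).
Implicit Types (W X Y : T -> R) (h : R -> R) (m s b c : R).
Local Notation mu := (@lebesgue_measure R).

(** Viewing the law as the image of the standard normal law under [m + s * x] puts the point mass
    [s = 0] and the case [0 < s] under one formula. *)
Lemma ge0_integral_gaussian_law W m s h :
  measurable_fun [set: T] W -> 0 <= s -> has_gaussian_law P W m s ->
  continuous h -> (forall x, 0 <= h x) ->
  (\int[P]_w (h (W w))%:E =
   \int[mu]_x (h (m + s * x) * normal_pdf 0 1 x)%:E)%E.
Proof.
move=> mW s0 lawW ch h0.
have mh : measurable_fun [set: R] h by exact: continuous_measurable_fun.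
have mEh := (measurable_EFinP _ _).2 mh.
have [s00|s00] := eqVneq s 0.
- have -> : (\int[P]_w (h (W w))%:E = \int[pushforward P W]_x (h x)%:E)%E.
    by rewrite ge0_integral_pushforward//= => x _; rewrite lee_fin.
  have -> : (\int[pushforward P W]_x (h x)%:E = \int[\d_m]_x (h x)%:E)%E.
    apply: eq_measure_integral => A mA _.
    by have := lawW A mA; rewrite /gaussian_law s00 eqxx.
  rewrite integral_dirac// diracT mul1e.
  transitivity (\int[mu]_x ((h m)%:E * (normal_pdf 0 1 x)%:E))%E.
    rewrite ge0_integralZl//= ?integral_normal_pdf ?mule1//.
    - by apply/measurable_EFinP; exact: measurable_normal_pdf.
    - by move=> x _; rewrite lee_fin normal_pdf_ge0.
    - by rewrite lee_fin.
  by apply: eq_integral => x _; rewrite s00 mul0r addr0 -EFinM.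
- have sgt0 : 0 < s by rewrite lt_neqAle eq_sym s00.
  (* normal_prob is a measure on this presentation of the Borel sigma-algebra *)
  pose R' := g_sigma_algebraType (R.-ocitv.-measurable).
  have -> : (\int[P]_w (h (W w))%:E =
             \int[pushforward P (W : T -> R')]_x (h x)%:E)%E.
    by rewrite ge0_integral_pushforward//= => x _; rewrite lee_fin.
  rewrite -(ge0_integral_normal_affine m sgt0 ch h0).
  apply: eq_measure_integral => A mA _.
  by have := lawW A mA; rewrite /gaussian_law (negbTE s00).
Qed.

Local Notation kappa := (@normal_second_moment R).

Lemma gaussian_law_central_moment2 W m s :
  measurable_fun [set: T] W -> 0 <= s -> has_gaussian_law P W m s ->
  (\int[P]_w ((W w - m) ^+ 2)%:E = (s ^+ 2)%:E * kappa)%E.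
Proof.
move=> mW s0 lawW.
rewrite (@ge0_integral_gaussian_law W m s (fun x => (x - m) ^+ 2))//; last 2 first.
- move=> x; apply: (@continuous_comp _ _ _ (fun x : R => x - m) (fun y => y ^+ 2)).
    by apply: continuousB => //; exact: cst_continuous.
  exact: exprn_continuous.
- by move=> x; exact: sqr_ge0.
under eq_integral do rewrite addrAC subrr add0r exprMn -mulrA EFinM.
rewrite ge0_integralZl//=.
- apply/measurable_EFinP; apply: measurable_funM; last exact: measurable_normal_pdf.
  by apply: measurable_funX.
- by move=> x _; rewrite lee_fin mulr_ge0 ?sqr_ge0 ?normal_pdf_ge0.
- by rewrite lee_fin sqr_ge0.
Qed.

Lemma Lfun2_sqr_integral W : measurable_fun [set: T] W ->
  (\int[P]_w (W w ^+ 2)%:E < +oo)%E -> W \in Lfun P 2%:E.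
Proof.
move=> mW fin; apply/andP; split; rewrite inE//=.
rewrite /finite_norm unlock /= poweR_lty//.
rewrite (eq_integral (fun w => (W w ^+ 2)%:E))// => w _ /=.
by rewrite powR_mulrn// -normrX ger0_norm ?sqr_ge0.
Qed.

Lemma gaussian_law_Lfun2 W m s :
  measurable_fun [set: T] W -> 0 <= s -> has_gaussian_law P W m s ->
  W \in Lfun P 2%:E.
Proof.
move=> mW s0 lawW.
have -> : W = (fun w => W w - m) \+ cst m.
  by apply/funext => w /=; rewrite subrK.
rewrite rpredD ?lee1n//= => _; last exact: Lfun_cst.
apply: Lfun2_sqr_integral; first exact: measurable_funB.
rewrite (gaussian_law_central_moment2 mW s0 lawW) lte_mul_pinfty//.
  by rewrite lee_fin sqr_ge0.
exact: normal_second_moment_lty.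
Qed.

(** The transfer formula handles nonnegative integrands only, so the mean is recovered from squares:
    by symmetry [W - m + 1] and [W - m - 1] have the same second moment, and the difference of their
    squares is [4 * (W - m)]. *)
Lemma gaussian_law_expectation W m s :
  measurable_fun [set: T] W -> 0 <= s -> has_gaussian_law P W m s ->
  ('E_P[W] = m%:E)%E.
Proof.
move=> mW s0 lawW.
have W2 := gaussian_law_Lfun2 mW s0 lawW.
have Pfin : P setT \is a fin_num := fin_num_measure P _ measurableT.
have W1 := Lfun_subset12 Pfin W2.
have cont (e : R) : continuous (fun x : R => (x - m + e) ^+ 2).
  move=> x.
  apply: (@continuous_comp _ _ _ (fun x : R => x - m + e) (fun y => y ^+ 2)).
    apply: continuousD; last exact: cst_continuous.
    by apply: continuousB => //; exact: cst_continuous.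
  exact: exprn_continuous.
have ge0 (e x : R) : 0 <= (x - m + e) ^+ 2 by exact: sqr_ge0.
have sym : (\int[P]_w ((W w - m + 1) ^+ 2)%:E = \int[P]_w ((W w - m - 1) ^+ 2)%:E)%E.
  rewrite (ge0_integral_gaussian_law mW s0 lawW (cont 1) (ge0 1)).
  rewrite (ge0_integral_gaussian_law mW s0 lawW (cont (-1)) (ge0 (-1))).
  rewrite ge0_integral_opp.
  - apply: eq_integral => x _; congr EFin; congr (_ * _).
      by rewrite -sqrrN; congr (_ ^+ 2); ring.
    by rewrite !normal_pdfE ?oner_eq0// /normal_fun !subr0 sqrrN.
  - have cf : continuous (fun x : R => (m + s * x - m + 1) ^+ 2).
      move=> x; apply: (@continuous_comp _ _ _ (fun x : R => m + s * x)
        (fun x => (x - m + 1) ^+ 2)); last exact: cont.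
      apply: continuousD; first exact: cst_continuous.
      by apply: continuousM => //; exact: cst_continuous.
    by move=> x; exact: (continuousM (cf x) (@continuous_normal_pdf R 0 1 (oner_neq0 R) x)).
  - by move=> x; rewrite mulr_ge0 ?normal_pdf_ge0 ?sqr_ge0.
pose V (e : R) := W \+ cst (e - m).
have V2 e : V e \in Lfun P 2%:E by rewrite rpredD ?lee1n//= => _; exact: Lfun_cst.
have VV1 e := Lfun2_mul_Lfun1 (V2 e) (V2 e).
have EV e : ('E_P[V e \* V e] = \int[P]_w ((W w - m + e) ^+ 2)%:E)%E.
  rewrite unlock; apply: eq_integral => w _; congr EFin.
  by rewrite /V /= expr2 addrA addrAC.
pose F := (V 1 \* V 1) \- (V (- 1) \* V (- 1)).
have : ('E_P[F] = 0)%E.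
  rewrite expectationB// !EV sym subee// -EV; exact: expectation_fin_num.
have -> : F = 4 \o* (W \- cst m).
  by apply/funext => w; rewrite /F /V /=; ring.
have c1 : (cst m : T -> R) \in Lfun P 1 by exact: Lfun_cst.
rewrite expectationZl ?rpredB// expectationB// expectation_cst.
have /fineK <- := expectation_fin_num W1.
rewrite -EFinB -EFinM => -[/eqP]; rewrite mulf_eq0 pnatr_eq0/= subr_eq0 => /eqP ->.
by [].
Qed.

Lemma gaussian_law_variance W m s :
  measurable_fun [set: T] W -> 0 <= s -> has_gaussian_law P W m s ->
  ('V_P[W] = (s ^+ 2)%:E * kappa)%E.
Proof.
move=> mW s0 lawW; rewrite -(gaussian_law_central_moment2 mW s0 lawW).
rewrite /variance unlock (gaussian_law_expectation mW s0 lawW) unlock.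
by apply: eq_integral => w _.
Qed.

(* The second moment of the standard normal law cancels out in the correlation,
   so its value is never needed. *)
Lemma std_bivariate_gaussian_combination (rho : R) (Z : T -> R * R) b c :
  measurable_fun [set: T] Z -> std_bivariate_gaussian P rho Z ->
  has_gaussian_law P (fun w => b * (Z w).1 + c * (Z w).2) 0
    (Num.sqrt (b ^+ 2 + c ^+ 2 + 2 * b * c * rho)).
Proof.
move=> mZ [bivZ lawX lawY corZ].
pose X w := (Z w).1; pose Y w := (Z w).2.
have mX : measurable_fun [set: T] X by exact: measurableT_comp.
have mY : measurable_fun [set: T] Y by exact: measurableT_comp.
have X2 := gaussian_law_Lfun2 mX ler01 lawX.
have Y2 := gaussian_law_Lfun2 mY ler01 lawY.
have Pfin : P setT \is a fin_num := fin_num_measure P _ measurableT.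
have X1 := Lfun_subset12 Pfin X2.
have Y1 := Lfun_subset12 Pfin Y2.
have VX := gaussian_law_variance mX ler01 lawX.
have VY := gaussian_law_variance mY ler01 lawY.
have EX := gaussian_law_expectation mX ler01 lawX.
have EY := gaussian_law_expectation mY ler01 lawY.
rewrite expr1n mul1e in VX; rewrite expr1n mul1e in VY.
have k0 : (0 < kappa)%E := normal_second_moment_gt0.
have kfin : kappa \is a fin_num.
  by rewrite ge0_fin_numE ?normal_second_moment_lty// ltW.
set k := fine kappa; have kE : kappa = k%:E by rewrite fineK.
have {}k0 : 0 < k by rewrite -lte_fin -kE.
have XY1 := Lfun2_mul_Lfun1 X2 Y2.
have covE : covariance P X Y = (rho * k)%:E.
  have cfin := covariance_fin_num X1 Y1 XY1.
  move: corZ; rewrite /correlation -/X -/Y VX VY -/k.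
  by rewrite -expr2 sqr_sqrtr ?ltW// => <-; rewrite divfK ?gt_eqF// fineK.
(* Joint Gaussianity gives some [m] and [s]; computing the mean and the variance by bilinearity
   identifies them. *)
have [m [s [s0 lawW]]] := bivZ b c.
set W := fun w => _ in lawW *.
have mW : measurable_fun [set: T] W.
  by apply: measurable_funD; apply: measurable_funM.
have WE : W = (b \o* X) \+ (c \o* Y).
  by apply/funext => w; rewrite /W /= [b * _]mulrC [c * _]mulrC.
have l12 : 1 <= 2 :> R by rewrite ler1n.
have EW := gaussian_law_expectation mW s0 lawW.
have VW := gaussian_law_variance mW s0 lawW.
have m0 : m = 0.
  move: EW; rewrite WE expectationD ?Lfun_scale// !expectationZl// EX EY !mule0 adde0.
  by move=> [].
have sE : s ^+ 2 = b ^+ 2 + c ^+ 2 + 2 * b * c * rho.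
  move: VW; rewrite WE varianceD ?Lfun_scale// !varianceZ// VX VY.
  rewrite covarianceZl ?Lfun_scale//; last first.
    by rewrite Lfun2_mul_Lfun1// Lfun_scale.
  rewrite covarianceZr// covE kE -!EFinM -!EFinD => -[].
  rewrite -mulrDl => /eqP.
  have -> : 2 * (b * (c * (rho * k))) = (2 * b * c * rho) * k by ring.
  by rewrite -mulrDl => /eqP/(mulIf (lt0r_neq0 k0)) ->.
by rewrite -sE sqrtr_sqr ger0_norm// -m0.
Qed.

End gaussian_laws.

(** * Half-planes and quadrants under one bivariate Gaussian law *)

Definition combination_var (R : realType) (rho b c : R) :=
  b ^+ 2 + c ^+ 2 + 2 * b * c * rho.

Definition halfplane (T : Type) (R : realType) (Z : T -> R * R) (b c y : R) :=
  [set w | y < b * (Z w).1 + c * (Z w).2].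

Section gaussian_quadrants.
Context d (T : measurableType d) (R : realType) (P : probability T R).
Variables (rho : R) (Z : T -> R * R).
Hypothesis rho1 : -1 <= rho <= 1.
Hypothesis mZ : measurable_fun [set: T] Z.
Hypothesis gZ : std_bivariate_gaussian P rho Z.
Implicit Types (a b c l m t u v x y : R).

Local Notation var := (combination_var rho).
Local Notation tail := (halfplane Z).

Lemma combination_var_ge0 b c : 0 <= var b c.
Proof.
have -> : var b c = (b + rho * c) ^+ 2 + (1 - rho) * (1 + rho) * c ^+ 2.
  by rewrite /combination_var; ring.
have /andP[r0 r1] := rho1.
apply: addr_ge0; first exact: sqr_ge0.
apply: mulr_ge0; last exact: sqr_ge0.
by apply: mulr_ge0; lra.
Qed.

Lemma measurable_halfplane b c y : measurable (tail b c y).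
Proof.
have mX : measurable_fun [set: T] (fun w => b * (Z w).1 + c * (Z w).2).
  apply: measurable_funD; apply: measurable_funM => //; exact: measurableT_comp.
have := mX measurableT `]y, +oo[%classic (measurable_itv _).
rewrite setTI; congr measurable; apply/seteqP; split=> w /=;
  by rewrite in_itv/= andbT.
Qed.

Let combination_tailE b c y :
  P (tail b c y) = gaussian_law 0 (Num.sqrt (var b c)) [set x | y < x].
Proof.
rewrite -(std_bivariate_gaussian_combination b c mZ gZ)//.
by rewrite -set_itvoy.
Qed.

(** The condition on [v] is written without a quotient so as to include variance 0: every [v] is
    then allowed, since the point mass at 0 does not charge the values above [y]. *)
Lemma combination_tail_le b c y v : 0 <= y -> v * var b c <= y ^+ 2 ->
  (P (tail b c y) <= (expR (- v / 2))%:E)%E.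
Proof.
move=> y0 vy; rewrite combination_tailE /gaussian_law.
have := combination_var_ge0 b c; rewrite le_eqVlt => /predU1P[<-|v0].
  rewrite sqrtr0 eqxx diracE memNset ?lee_fin ?expR_ge0//=.
  by apply/negP; rewrite -leNgt.
have s0 : 0 < Num.sqrt (var b c) by rewrite sqrtr_gt0.
rewrite (negbTE (lt0r_neq0 s0)).
apply: le_trans (normal_prob_tail_le s0 y0) _.
rewrite lee_fin ler_expR (sqr_sqrtr (ltW v0)) !mulNr lerN2.
rewrite ler_pdivlMr ?pmulrn_lgt0// -[var b c *+ 2]mulr_natr.
by rewrite (_ : v / 2 * _ = v * var b c)//; field.
Qed.

Lemma combination_tail_ge b c y : 0 <= y -> var b c = 1 ->
  ((normal_peak 1 * expR (- (y + 1) ^+ 2 / 2))%:E <= P (tail b c y))%E.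
Proof.
move=> y0 v1; rewrite combination_tailE v1 sqrtr1 /gaussian_law oner_eq0.
exact: normal_prob01_tail_ge.
Qed.

(* Tilting by - t M, where t l is the excess of the conditional mean of M given
   L = l over m, strictly increases the Gaussian exponent. *)
Lemma combination_strip_le b c p q l m :
  var b c = 1 -> var p q = 1 -> 0 < l -> 0 < m ->
  m < (b * p + c * q + rho * (b * q + c * p)) * l ->
  exists2 v, l ^+ 2 < v & forall a, 0 < a ->
    (P (tail b c (a * l) `&` [set w | (p * (Z w).1 + q * (Z w).2 <= a * m)%R])
      <= (expR (- (a ^+ 2 * v) / 2))%:E)%E.
Proof.
(* [k] is the covariance of L and M, and [k * l] the conditional mean of M given L = l. *)
move=> v1 v2 l0 m0; set k := _ + rho * _ => mkl.
have varE t : var (b - t * p) (c - t * q) = 1 - 2 * t * k + t ^+ 2.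
  transitivity (var b c - 2 * t * k + t ^+ 2 * var p q).
    by rewrite /combination_var /k; ring.
  by rewrite v1 v2 mulr1.
(* L - M has variance [2 - 2 * k]. *)
have k1 : k <= 1 by have := combination_var_ge0 (b - 1 * p) (c - 1 * q); rewrite varE; lra.
pose t := k - m / l.
have tl : t * l = k * l - m by rewrite /t mulrBl divfK ?gt_eqF.
have t0 : 0 < t by rewrite -(pmulr_lgt0 _ l0) tl; lra.
have vt0 : 0 <= 1 - 2 * t * k + t ^+ 2 by rewrite -varE combination_var_ge0.
set vt := 1 - 2 * t * k + t ^+ 2 in vt0.
have ml : m < l by nra.
have tm : 0 < l - t * m.
  have : t <= 1 by rewrite /t; have := divr_gt0 m0 l0; lra.
  nra.
(* As [m = k * l - t * l], [(l - t * m) ^+ 2] equals [l ^+ 2 * vt + t ^+ 2 * (l ^+ 2 + m ^+ 2)].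
   Dividing the surplus by [vt + 1] instead of [vt] keeps the gain [e] meaningful when [vt = 0]. *)
pose e := t ^+ 2 * (l ^+ 2 + m ^+ 2) / (vt + 1).
have vt1 : 0 < vt + 1 by lra.
have e0 : 0 < e.
  rewrite /e; apply: divr_gt0 => //; apply: mulr_gt0; first exact: exprn_gt0.
  by apply: addr_gt0; exact: exprn_gt0.
have evt : e * vt <= t ^+ 2 * (l ^+ 2 + m ^+ 2).
  have : e * (vt + 1) = t ^+ 2 * (l ^+ 2 + m ^+ 2).
    by rewrite /e divfK// gt_eqF.
  lra.
exists (l ^+ 2 + e); first by lra.
move=> a a0.
apply: (@le_trans _ _ (P (tail (b - t * p) (c - t * q) (a * (l - t * m))))).
  apply: le_measure; rewrite ?inE.
  - apply: measurableI; first exact: measurable_halfplane.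
    rewrite (_ : [set _ | _] = ~` tail p q (a * m)).
      exact/measurableC/measurable_halfplane.
    by apply/seteqP; split=> w /=; rewrite /halfplane /= leNgt => /negP.
  - exact: measurable_halfplane.
  - move=> w []; rewrite /halfplane /= => Hl /(ler_wpM2l (ltW t0)) Hm; lra.
apply: combination_tail_le; first by rewrite mulr_ge0 ?ltW.
rewrite varE -/vt exprMn -mulrA ler_wpM2l ?sqr_ge0//.
have -> : (l - t * m) ^+ 2 = l ^+ 2 * vt + t ^+ 2 * (l ^+ 2 + m ^+ 2).
  have -> : m = k * l - t * l by lra.
  by rewrite /vt; ring.
by rewrite mulrDl; lra.
Qed.

(** With L = bX + cY, the covariances of L with X and Y are [b + rho * c] and [c + rho * b]. The
    hypotheses thus place the conditional mean of (X, Y) given L = l strictly inside the quadrant,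
    which makes both strips outside it negligible against the half-plane. *)
Lemma quadrant_ge b c l (u1 u2 : R) :
  var b c = 1 -> 0 < l -> 0 < u1 < (b + rho * c) * l ->
  0 < u2 < (c + rho * b) * l ->
  exists2 v, l ^+ 2 < v & forall a, 0 < a ->
    ((normal_peak 1 * expR (- (a * l + 1) ^+ 2 / 2))%:E <=
     P [set w | (a * u1 < (Z w).1)%R /\ (a * u2 < (Z w).2)%R] +
     (2 * expR (- (a ^+ 2 * v) / 2))%:E)%E.
Proof.
move=> v1 l0 /andP[u10 u1l] /andP[u20 u2l].
have [|||||x lx Hx] := @combination_strip_le b c 1 0 l u1 => //.
- by rewrite /combination_var; ring.
- by rewrite !mulr1 !mulr0 addr0 add0r.
have [|||||y ly Hy] := @combination_strip_le b c 0 1 l u2 => //.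
- by rewrite /combination_var; ring.
- by rewrite !mulr1 !mulr0 addr0 add0r.
exists (Num.min x y); first by rewrite lt_min lx ly.
move=> a a0.
apply: le_trans (combination_tail_ge _ v1) _; first by rewrite mulr_ge0 ?ltW.
set Q := [set _ | _].
set S1 := tail b c (a * l) `&` [set w | 1 * (Z w).1 + 0 * (Z w).2 <= a * u1].
set S2 := tail b c (a * l) `&` [set w | 0 * (Z w).1 + 1 * (Z w).2 <= a * u2].
have mtail := measurable_halfplane.
have mQ : measurable Q.
  rewrite (_ : Q = tail 1 0 (a * u1) `&` tail 0 1 (a * u2)); first exact: measurableI.
  by apply/seteqP; split=> w; rewrite /Q /halfplane /= !mul1r !mul0r addr0 add0r.
have mS (p q s : R) : measurable (tail b c (a * l) `&` [set w | p * (Z w).1 + q * (Z w).2 <= s]).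
  apply: measurableI => //.
  rewrite (_ : [set _ | _] = ~` tail p q s); first exact: measurableC.
  by apply/seteqP; split=> w /=; rewrite /halfplane /= leNgt => /negP.
have mS1 : measurable S1 by exact: mS.
have mS2 : measurable S2 by exact: mS.
have sub : tail b c (a * l) `<=` Q `|` (S1 `|` S2).
  move=> w Lw.
  have [h1|h1] := ltP (a * u1) (Z w).1; last first.
    by right; left; split => //=; rewrite mul1r mul0r addr0.
  have [h2|h2] := ltP (a * u2) (Z w).2; last first.
    by right; right; split => //=; rewrite mul1r mul0r add0r.
  by left.
apply: (@le_trans _ _ (P (Q `|` (S1 `|` S2)))).
  by apply: le_measure; rewrite ?inE//; do 2?apply: measurableU.
apply: le_trans (measureU2 P mQ (measurableU _ _ mS1 mS2)) _.
rewrite leeD2l//; apply: le_trans (measureU2 P mS1 mS2) _.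
rewrite [2]mulr2n mulrDl mul1r EFinD leeD//.
- apply: le_trans (Hx a a0) _; rewrite lee_fin ler_expR !mulNr lerN2.
  by rewrite ler_wpM2r// ler_wpM2l ?sqr_ge0// ge_min lexx.
- apply: le_trans (Hy a a0) _; rewrite lee_fin ler_expR !mulNr lerN2.
  by rewrite ler_wpM2r// ler_wpM2l ?sqr_ge0// ge_min lexx orbT.
Qed.

(** The gap [a ^+ 2 * (v - l ^+ 2)] is quadratic in [a], whereas the shift by 1 costs only
    [2 * a * l + 1]. The factor 3 leaves room for two strips and the desired lower bound. *)
Lemma gaussian_exponent_gap (K l v : R) : 0 < K -> 0 <= l -> l ^+ 2 < v ->
  exists2 A : R, 0 < A & forall a, A <= a ->
    3 * expR (- (a ^+ 2 * v) / 2) <= K * expR (- (a * l + 1) ^+ 2 / 2).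
Proof.
move=> K0 l0 lv.
pose e := v - l ^+ 2; have e0 : 0 < e by rewrite subr_gt0.
have C0 : 0 < 3 / K by rewrite divr_gt0.
(* The leading 1 ensures [1 <= a]. The term [3 / K] absorbs the constants, as
   [3 / K <= expR (3 / K)]. *)
pose A := 1 + (2 * l + 1 + 2 * (3 / K)) / e.
have A0 : 0 < (2 * l + 1 + 2 * (3 / K)) / e by rewrite divr_gt0//; lra.
exists A; first by rewrite /A; lra.
move=> a Aa.
have a1 : 1 <= a by apply: le_trans Aa; rewrite /A; lra.
have ae : 2 * l + 1 + 2 * (3 / K) <= a * e.
  by rewrite -ler_pdivrMr//; apply: le_trans Aa; rewrite /A; lra.
have main : 3 / K + - (a ^+ 2 * v) / 2 <= - (a * l + 1) ^+ 2 / 2.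
  have -> : v = e + l ^+ 2 by rewrite /e; ring.
  have : a * (2 * l + 1 + 2 * (3 / K)) <= a * (a * e) by rewrite ler_wpM2l//; lra.
  nra.
rewrite -ler_pdivrMl// mulrA [K^-1 * _]mulrC.
apply: (@le_trans _ _ (expR (3 / K) * expR (- (a ^+ 2 * v) / 2))).
  rewrite ler_wpM2r ?expR_ge0//; have := expR_ge1Dx (3 / K); lra.
by rewrite -expRD ler_expR.
Qed.

(** Boundary cases are allowed because [l] can be raised to some [l'] with [l' ^+ 2 < v]: both
    covariances are positive, so the inequalities on [u1] and [u2] become strict at [l']. *)
Lemma quadrant_lower_bound b c l v (u1 u2 : R) :
  var b c = 1 -> 0 < l -> 0 < u1 <= (b + rho * c) * l ->
  0 < u2 <= (c + rho * b) * l -> l ^+ 2 < v ->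
  exists2 A : R, 0 < A & forall a, A <= a ->
   ((expR (- (a ^+ 2 * v) / 2))%:E <=
     P [set w | (a * u1 < (Z w).1)%R /\ (a * u2 < (Z w).2)%R])%E.
Proof.
move=> v1 l0 /andP[u10 u1l] /andP[u20 u2l] lv.
have K0 : 0 < normal_peak (1 : R) by rewrite normal_peak_gt0// oner_eq0.
have v0 : 0 <= v by apply: le_trans (ltW lv); exact: sqr_ge0.
have lsv : l < Num.sqrt v by rewrite -(ger0_norm (ltW l0)) -sqrtr_sqr ltr_sqrt//; nra.
have svv : Num.sqrt v ^+ 2 = v by rewrite sqr_sqrtr.
set r := Num.sqrt v in lsv svv.
pose l' := (l + r) / 2.
have l'1 : l < l' by rewrite /l'; lra.
have l'2 : l' < r by rewrite /l'; lra.
have c10 : 0 < b + rho * c by rewrite -(pmulr_lgt0 _ l0); lra.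
have c20 : 0 < c + rho * b by rewrite -(pmulr_lgt0 _ l0); lra.
have [||||x lx Hx] := @quadrant_ge b c l' u1 u2 => //.
- by lra.
- by rewrite u10 (le_lt_trans u1l)// ltr_pM2l.
- by rewrite u20 (le_lt_trans u2l)// ltr_pM2l.
have l'v : l' ^+ 2 < Num.min x v by rewrite lt_min lx/= -svv; nra.
have [|A A0 HA] := gaussian_exponent_gap K0 _ l'v; first by lra.
exists A => // a Aa.
have a0 : 0 < a by exact: lt_le_trans Aa.
have := Hx a a0.
set Q := P _.
have mQ : measurable [set w | (a * u1 < (Z w).1)%R /\ (a * u2 < (Z w).2)%R].
  rewrite (_ : [set _ | _] = tail 1 0 (a * u1) `&` tail 0 1 (a * u2)).
    by apply: measurableI; exact: measurable_halfplane.
  by apply/seteqP; split=> w; rewrite /halfplane /= !mul1r !mul0r addr0 add0r.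
have /fineK <- : Q \is a fin_num by exact: fin_num_measure.
rewrite -EFinD !lee_fin.
have := HA a Aa.
have m1 : expR (- (a ^+ 2 * x) / 2) <= expR (- (a ^+ 2 * Num.min x v) / 2).
  by rewrite ler_expR !mulNr lerN2 ler_wpM2r// ler_wpM2l ?sqr_ge0// ge_min lexx.
have m2 : expR (- (a ^+ 2 * v) / 2) <= expR (- (a ^+ 2 * Num.min x v) / 2).
  by rewrite ler_expR !mulNr lerN2 ler_wpM2r// ler_wpM2l ?sqr_ge0// ge_min lexx orbT.
lra.
Qed.

End gaussian_quadrants.

(** * Logarithmic asymptotics at speed [a n ^+ 2] *)

Section logarithmic_scale.
Context {R : realType}.
Implicit Types (a : nat -> R) (p : nat -> \bar R) (A J : R).

Lemma dominates_sqrt_log_ge a A : dominates_sqrt_log a ->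
  \forall n \near \oo, A * Num.sqrt (ln n%:R) <= a n.
Proof.
move=> [_ /cvgryPge/(_ A) ha]; near=> n.
have n1 : (2 <= n)%N by near: n; exact: nbhs_infty_ge.
have l0 : 0 < Num.sqrt (ln n%:R) :> R.
  by rewrite sqrtr_gt0 ln_gt0// ltr1n.
rewrite -ler_pdivlMr//.
by near: n.
Unshelve. all: by end_near.
Qed.

Lemma dominates_sqrt_log_cvgy a A : dominates_sqrt_log a ->
  \forall n \near \oo, A <= a n.
Proof.
move=> da.
have l2 : 0 < Num.sqrt (ln 2) :> R by rewrite sqrtr_gt0 ln_gt0// ltr1n.
have h := dominates_sqrt_log_ge (`|A| / Num.sqrt (ln 2)) da.
near=> n.
have n2 : (2 <= n)%N by near: n; exact: nbhs_infty_ge.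
have hn : `|A| / Num.sqrt (ln 2) * Num.sqrt (ln n%:R) <= a n by near: n.
apply: le_trans (ler_norm A) _; apply: le_trans hn.
rewrite mulrAC ler_pdivlMr// ler_wpM2l// ler_wsqrtr// ler_ln ?posrE ?ltr0n//.
  by rewrite ler_nat.
by rewrite (leq_trans _ n2).
Unshelve. all: by end_near.
Qed.

(** After taking logarithms and dividing by [a n ^+ 2], the prefactor [n%:R ^+ 2] contributes
    [2 * ln n%:R / a n ^+ 2], which tends to 0. *)
Lemma cvg_log_scale a p J : dominates_sqrt_log a ->
  (\forall n \near \oo, (p n <= (n%:R ^+ 2 * expR (- (a n ^+ 2 * J) / 2))%:E)%E) ->
  (forall v, J < v ->
    \forall n \near \oo, ((expR (- (a n ^+ 2 * v) / 2))%:E <= p n)%E) ->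
  (((a n ^+ 2)^-1)%:E * lne (p n))%E @[n --> \oo] --> (- (J / 2))%:E.
Proof.
move=> da ub lb.
have real v : J < v -> \forall n \near \oo, exists q : R,
    [/\ p n = q%:E, expR (- (a n ^+ 2 * v) / 2) <= q &
        q <= n%:R ^+ 2 * expR (- (a n ^+ 2 * J) / 2)].
  move=> Jv; have := lb v Jv => lbv; near=> n.
  have : ((expR (- (a n ^+ 2 * v) / 2))%:E <= p n)%E by near: n.
  have : (p n <= (n%:R ^+ 2 * expR (- (a n ^+ 2 * J) / 2))%:E)%E by near: n.
  by case: (p n) => [q| |]//; rewrite !lee_fin => qu ql; exists q.
apply/fine_cvgP; split.
  (* Any exponent above [J] would do: it makes [p n] positive, hence its logarithm finite. *)
  have h := real (J + 1) (ltr_pwDr ltr01 (lexx J)).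
  near=> n.
  have [q [-> ql _]] : exists q : R,
    [/\ p n = q%:E, expR (- (a n ^+ 2 * (J + 1)) / 2) <= q &
        q <= n%:R ^+ 2 * expR (- (a n ^+ 2 * J) / 2)] by near: n.
  by rewrite lne_EFin ?(lt_le_trans _ ql) ?expR_gt0.
apply/cvgrPdist_le => e e0.
(* Exponents are halved, so [2 * e] here is an error [e] in the limit; likewise [Num.sqrt (2 / e)]
   below yields [2 * ln n%:R <= e * a n ^+ 2]. *)
have h := real (J + 2 * e) (ltr_pwDr (mulr_gt0 (ltr0Sn R 1) e0) (lexx J)).
have h1 := dominates_sqrt_log_ge (Num.sqrt (2 / e)) da.
have h2 := dominates_sqrt_log_cvgy 1 da.
near=> n.
have [q [pq ql qu]] : exists q : R,
  [/\ p n = q%:E, expR (- (a n ^+ 2 * (J + 2 * e)) / 2) <= q &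
      q <= n%:R ^+ 2 * expR (- (a n ^+ 2 * J) / 2)] by near: n.
have q0 : 0 < q by rewrite (lt_le_trans _ ql)// expR_gt0.
have n2 : (2 <= n)%N by near: n; exact: nbhs_infty_ge.
have n0 : 0 < n%:R :> R by rewrite ltr0n (leq_trans _ n2).
have a0 : 0 < a n by rewrite (lt_le_trans ltr01)//; near: n.
have a20 : 0 < a n ^+ 2 by rewrite exprn_gt0.
have ln0 : 0 <= ln n%:R :> R by rewrite ln_ge0// ler1n (leq_trans _ n2).
have lnn : 2 * ln n%:R <= e * a n ^+ 2.
  have : Num.sqrt (2 / e) * Num.sqrt (ln n%:R) <= a n by near: n.
  rewrite -ler_sqr ?nnegrE ?mulr_ge0 ?sqrtr_ge0 ?(ltW a0)//.
  rewrite exprMn (sqr_sqrtr ln0) sqr_sqrtr ?divr_ge0 ?(ltW e0)//.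
  by rewrite mulrAC ler_pdivrMr// [_ * e]mulrC.
have lnq_ge : - (a n ^+ 2 * (J + 2 * e)) / 2 <= ln q.
  by rewrite -[leLHS]expRK ler_ln ?posrE ?expR_gt0.
have lnq_le : ln q <= 2 * ln n%:R - a n ^+ 2 * J / 2.
  have -> : 2 * ln n%:R - a n ^+ 2 * J / 2 =
      ln (n%:R ^+ 2 * expR (- (a n ^+ 2 * J) / 2)).
    rewrite lnM ?posrE ?exprn_gt0 ?expR_gt0// expRK lnXn// mulNr.
    by rewrite [2 * _]mulrC mulr_natr.
  by rewrite ler_ln ?posrE// mulr_gt0 ?exprn_gt0 ?expR_gt0.
rewrite /= pq lne_EFin//= ler_norml.
apply/andP; split.
  have : (a n ^+ 2)^-1 * ln q <= e - J / 2.
    rewrite ler_pdivrMl//; nra.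
  lra.
have : - e - J / 2 <= (a n ^+ 2)^-1 * ln q.
  rewrite ler_pdivlMl//; nra.
lra.
Unshelve. all: by end_near.
Qed.

End logarithmic_scale.

(** * The event on componentwise maxima as a union over pairs of indices *)

Lemma lt_bigmax_ord (R : realType) (f : nat -> R) (n : nat) (x : R) : (0 < n)%N ->
  x < \big[Num.max/f 0%N]_(i < n) f i <-> exists2 i, (i < n)%N & x < f i.
Proof.
move=> n0; split=> [|[i ni xi]].
  apply: contraPP => /forall2NP h; apply/negP; rewrite -leNgt.
  apply/bigmax_leP; split=> [|i _].
    by have [//|/negP] := h 0%N; rewrite -leNgt.
  by have [/negP|/negP] := h (val i); rewrite ?ltn_ord// -leNgt.
apply: lt_le_trans xi _; exact: (le_bigmax _ _ (Ordinal ni)).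
Qed.

Section componentwise_maximum.
Context d (T : measurableType d) (R : realType) (P : probability T R).
Variable Z : nat -> {RV P >-> (R * R)%type}.
Implicit Types (x y : R) (i j n : nat).

Local Notation pair_gt i j x y := [set w | x < (Z i w).1 /\ y < (Z j w).2].

Lemma measurable_RV_pair i : measurable_fun [set: T] (Z i : T -> R * R).
Proof. exact: measurable_funP. Qed.

Lemma measurable_pair_gt i j x y : measurable (pair_gt i j x y).
Proof.
rewrite (_ : [set _ | _] = halfplane (Z i) 1 0 x `&` halfplane (Z j) 0 1 y).
  by apply: measurableI; exact: (measurable_halfplane (measurable_RV_pair _)).
by apply/seteqP; split=> w; rewrite /halfplane /= !mul1r !mul0r addr0 add0r.
Qed.

Lemma pair_gt_independent i j x y : mutually_independent Z -> i != j ->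
  P (pair_gt i j x y) =
  (P (halfplane (Z i) 1%R 0%R x) * P (halfplane (Z j) 0%R 1%R y))%E.
Proof.
move=> ind ij.
(* With [id] for the random vector, these are half-planes of the plane itself, whose preimages are
   the events in the statement. *)
pose A : set (R * R) := halfplane id 1 0 x.
pose B : set (R * R) := halfplane id 0 1 y.
have mA : measurable A by exact: measurable_halfplane.
have mB : measurable B by exact: measurable_halfplane.
have mAB k : measurable (if k == i then A else B) by case: ifP.
have := ind [:: i; j] (fun k => if k == i then A else B).
rewrite /= inE ij => /(_ isT mAB).
rewrite !big_cons !big_nil setIT mule1 eqxx eq_sym (negbTE ij) => <-.
congr (P _); apply/seteqP; split=> w;
  by rewrite /A /B /halfplane /= !mul1r !mul0r addr0 add0r.
Qed.

Lemma Zbar_gtE (n : nat) (z : R * R) : (0 < n)%N ->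
  [set w | vec_gt (Zbar (fun i => Z i : T -> R * R) n w) z] =
  \big[setU/set0]_(i < n) \big[setU/set0]_(j < n) pair_gt i j z.1 z.2.
Proof.
move=> n0; rewrite -(bigcup_mkord n (fun i => \big[setU/set0]_(j < n) pair_gt i j z.1 z.2)).
apply/seteqP; split=> w.
  move=> [/= /(lt_bigmax_ord (fun i => (Z i w).1) _ n0)[i ni zi]].
  move=> /(lt_bigmax_ord (fun i => (Z i w).2) _ n0)[j nj zj].
  exists i => //; rewrite -(bigcup_mkord n (fun j => pair_gt i j z.1 z.2)).
  by exists j.
move=> [i /= ni]; rewrite -(bigcup_mkord n (fun j => pair_gt i j z.1 z.2)).
move=> [j /= nj [zi zj]]; split.
  by apply/(lt_bigmax_ord (fun i => (Z i w).1) _ n0); exists i.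
by apply/(lt_bigmax_ord (fun i => (Z i w).2) _ n0); exists j.
Qed.

Lemma measurable_Zbar_gt n (z : R * R) : (0 < n)%N ->
  measurable [set w | vec_gt (Zbar (fun i => Z i : T -> R * R) n w) z].
Proof.
move=> n0; rewrite Zbar_gtE//; apply: bigsetU_measurable => i _.
by apply: bigsetU_measurable => j _; exact: measurable_pair_gt.
Qed.

(** The union bound is applied twice, once per index, each time at the cost of a factor [n]. *)
Lemma Zbar_gt_le n (z : R * R) (r : R) : (0 < n)%N ->
  (forall i j, P (pair_gt i j z.1 z.2) <= r%:E)%E ->
  (P [set w | vec_gt (Zbar (fun i => Z i : T -> R * R) n w) z] <=
   (n%:R ^+ 2 * r)%:E)%E.
Proof.
move=> n0 le_r; rewrite Zbar_gtE//.
have union (F : nat -> set T) (s : R) : (forall i, measurable (F i)) ->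
    (forall i, P (F i) <= s%:E)%E ->
    (P (\big[setU/set0]_(i < n) F i) <= (n%:R * s)%:E)%E.
  move=> mF Fs; apply: le_trans (Boole_inequality P _) _ => //.
  apply: (@le_trans _ _ (\sum_(i < n) s%:E)%E); first by apply: lee_sum => i _; exact: Fs.
  by rewrite sumEFin sumr_const card_ord mulr_natl.
rewrite expr2 -mulrA.
apply: (union (fun i => \big[setU/set0]_(j < n) pair_gt i j z.1 z.2)) => i.
  by apply: bigsetU_measurable => j _; exact: measurable_pair_gt.
by apply: (union (fun j => pair_gt i j z.1 z.2)) => j //; exact: measurable_pair_gt.
Qed.

Lemma Zbar_gt_ge n i j (z : R * R) : (i < n)%N -> (j < n)%N ->
  (P (pair_gt i j z.1 z.2) <=
   P [set w | vec_gt (Zbar (fun i => Z i : T -> R * R) n w) z])%E.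
Proof.
move=> ni nj; have n0 : (0 < n)%N by exact: leq_ltn_trans ni.
apply: le_measure; rewrite ?inE; [exact: measurable_pair_gt|by apply: measurable_Zbar_gt|].
move=> w [zi zj]; split.
  by apply/(lt_bigmax_ord (fun i => (Z i w).1) _ n0); exists i.
by apply/(lt_bigmax_ord (fun i => (Z i w).2) _ n0); exists j.
Qed.

End componentwise_maximum.

(** * Exponents of the pair events and the limit *)

(** For [-1 < rho < 1] this is the quadratic form of the inverse correlation matrix at [u]. *)
Definition mahalanobis (R : realType) (rho : R) (u : R * R) :=
  (u.1 ^+ 2 - 2 * rho * u.1 * u.2 + u.2 ^+ 2) / (1 - rho ^+ 2).

(* J is twice the rate; rho = 1 falls under the first case as u.2 <= u.1. *)
Definition rate_case (R : realType) (rho : R) (u : R * R) (J : R) :=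
  [\/ u.2 <= rho * u.1 /\ J = u.1 ^+ 2,
      rho = -1 /\ J = sqnorm2 u |
      [/\ -1 < rho < 1, rho * u.1 < u.2 &
          J = Num.min (sqnorm2 u) (mahalanobis rho u)]].

Section extremes.
Context (R : realType) (d : measure_display) (T : measurableType d).
Variables (P : probability T R) (rho : R) (Z : nat -> {RV P >-> (R * R)%type}).
Hypothesis rho1 : -1 <= rho <= 1.
Hypothesis gZ : forall i, std_bivariate_gaussian P rho (Z i).
Hypothesis indZ : mutually_independent Z.
Implicit Types (a v J : R) (u : R * R) (n : nat).

Let mZ i : measurable_fun [set: T] (Z i : T -> R * R).
Proof. exact: measurable_RV_pair. Qed.

Local Notation pair_gt i j x y := [set w | x < (Z i w).1 /\ y < (Z j w).2].

Lemma pair_gt_le_halfplane i b c (x y v : R) : 0 <= b -> 0 <= c -> 0 < b + c ->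
  0 <= b * x + c * y ->
  v * combination_var rho b c <= (b * x + c * y) ^+ 2 ->
  (P (pair_gt i i x y) <= (expR (- v / 2))%:E)%E.
Proof.
move=> b0 c0 bc0 xy0 le_v.
apply: le_trans (combination_tail_le rho1 (mZ i) (gZ i) xy0 le_v).
apply: le_measure; rewrite ?inE.
- exact: measurable_pair_gt.
- exact: measurable_halfplane.
- move=> w [/= xw yw]; rewrite /halfplane /=.
  have hx := ler_wpM2l b0 (ltW xw); have hy := ler_wpM2l c0 (ltW yw).
  (* Strictness must come from a positive coefficient: [c] if [b = 0], and [b] otherwise. *)
  have [b00|b00] := eqVneq b 0; first by rewrite b00 in hx bc0 *; nra.
  have : b * x < b * (Z i w).1 by rewrite ltr_pM2l// lt_neqAle eq_sym b00.
  lra.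
Qed.

Lemma distinct_pair_gt_le i j (x y : R) : i != j -> 0 <= x -> 0 <= y ->
  (P (pair_gt i j x y) <= (expR (- (x ^+ 2 + y ^+ 2) / 2))%:E)%E.
Proof.
move=> ij x0 y0; rewrite (pair_gt_independent _ _ indZ ij).
have -> : - (x ^+ 2 + y ^+ 2) / 2 = - x ^+ 2 / 2 + - y ^+ 2 / 2 by field.
rewrite expRD EFinM lee_pmul//.
- apply: (combination_tail_le rho1 (mZ i) (gZ i)) => //.
  by rewrite /combination_var; lra.
- apply: (combination_tail_le rho1 (mZ j) (gZ j)) => //.
  by rewrite /combination_var; lra.
Qed.

Lemma distinct_pair_gt_ge i j (x y v : R) : i != j -> 0 < x -> 0 < y ->
  x ^+ 2 + y ^+ 2 < v ->
  exists2 A : R, 0 < A & forall a, A <= a ->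
   ((expR (- (a ^+ 2 * v) / 2))%:E <= P (pair_gt i j (a * x)%R (a * y)%R))%E.
Proof.
move=> ij x0 y0 xyv.
have K0 : 0 < normal_peak (1 : R) by rewrite normal_peak_gt0// oner_eq0.
(* The excess of [v] is shared equally between the two independent tails. *)
pose e := (v - (x ^+ 2 + y ^+ 2)) / 2.
have [|A A0 HA] := @gaussian_exponent_gap R _ x (x ^+ 2 + e) K0 (ltW x0).
  by rewrite /e; lra.
have [|B B0 HB] := @gaussian_exponent_gap R _ y (y ^+ 2 + e) K0 (ltW y0).
  by rewrite /e; lra.
exists (Num.max A B); first by rewrite lt_max A0.
move=> a; rewrite ge_max => /andP[Aa Ba].
have a0 : 0 <= a by apply: le_trans Aa; exact: ltW.
rewrite (pair_gt_independent _ _ indZ ij).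
have -> : - (a ^+ 2 * v) / 2 =
    - (a ^+ 2 * (x ^+ 2 + e)) / 2 + - (a ^+ 2 * (y ^+ 2 + e)) / 2.
  by rewrite /e; field.
have drop3 (s t : R) : 0 <= s -> 3 * s <= t -> s <= t by lra.
rewrite expRD EFinM lee_pmul ?lee_fin ?expR_ge0//.
- apply: le_trans (combination_tail_ge (mZ i) (gZ i) _ _).
  + by rewrite lee_fin; apply: drop3 (HA a Aa); exact: expR_ge0.
  + by rewrite mulr_ge0// ltW.
  + by rewrite /combination_var; ring.
- apply: le_trans (combination_tail_ge (mZ j) (gZ j) _ _).
  + by rewrite lee_fin; apply: drop3 (HB a Ba); exact: expR_ge0.
  + by rewrite mulr_ge0// ltW.
  + by rewrite /combination_var; ring.
Qed.

Lemma rate_cases u : 0 < u.1 -> 0 < u.2 -> u.2 <= u.1 ->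
  exists2 J, rate rho u = (J / 2)%:E &
  rate_case rho u J.
Proof.
move=> u1 u2 u21; rewrite /rate; case: ifPn => [le_u|].
  by exists (u.1 ^+ 2); [rewrite mulrC|apply: Or31].
rewrite -ltNge => lt_u.
have /andP[r0 r1] := rho1.
(* At [rho = -1] the quotient in [rate] is [+oo], so the minimum is [sqnorm2 u]. *)
have [rN|rN] := eqVneq rho (-1).
  exists (sqnorm2 u); last by apply: Or32.
  rewrite rN sqrrN expr1n subrr inve0 gt0_muley; last first.
    by rewrite lte_fin; nra.
  by rewrite minEle leey -EFinM mulrC.
(* [rho = 1] would give [u.1 < u.2]. *)
have rho_lt1 : rho < 1 by nra.
have rho_gtN1 : -1 < rho by rewrite lt_neqAle eq_sym rN.
have q0 : 0 < 1 - rho ^+ 2 by nra.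
exists (Num.min (sqnorm2 u) (mahalanobis rho u)); last first.
  by apply: Or33; split=> //; rewrite rho_gtN1.
rewrite inver gt_eqF// -EFinM -EFin_min -EFinM; congr EFin; exact: mulrC.
Qed.


Lemma pair_gt_le_rate u J a i j : 0 < u.1 -> 0 < u.2 -> u.2 <= u.1 ->
  rate_case rho u J ->
  0 < a ->
  (P (pair_gt i j (a * u.1)%R (a * u.2)%R) <= (expR (- (a ^+ 2 * J) / 2))%:E)%E.
Proof.
move=> u1 u2 u21 cases a0.
have au1 : 0 < a * u.1 by exact: mulr_gt0.
have au2 : 0 < a * u.2 by exact: mulr_gt0.
have distinct : i != j -> J <= sqnorm2 u ->
    (P (pair_gt i j (a * u.1)%R (a * u.2)%R) <= (expR (- (a ^+ 2 * J) / 2))%:E)%E.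
  move=> ij Jle; apply: le_trans (distinct_pair_gt_le ij (ltW au1) (ltW au2)) _.
  rewrite lee_fin ler_expR !mulNr lerN2 ler_wpM2r// !exprMn -mulrDr.
  by rewrite ler_wpM2l ?sqr_ge0.
have [ij|ij] := eqVneq i j; last first.
  apply: distinct => //; case: cases => [[_ ->]|[_ ->]//|[_ _ ->]].
    by rewrite /sqnorm2 lerDl sqr_ge0.
  by rewrite ge_min lexx.
rewrite -{}ij {distinct}.
case: cases => [[_ ->]|[rhoN ->]|[/andP[r0 r1] lt_u ->]].
(* Only the first component is constrained here. *)
- apply: (@pair_gt_le_halfplane i 1 0) => //; first by lra.
  by rewrite mul1r mul0r addr0 exprMn /combination_var; lra.
(* For [rho = -1] the sum of the two components has variance 0, so any exponent is admissible. *)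
- apply: (@pair_gt_le_halfplane i 1 1) => //; first by lra.
  have -> : combination_var rho 1 1 = 0 by rewrite /combination_var rhoN; ring.
  by rewrite mulr0 sqr_ge0.
- have D0 : 0 < 1 - rho ^+ 2 by nra.
  have b0 : 0 < u.1 - rho * u.2 by nra.
  have c0 : 0 < u.2 - rho * u.1 by lra.
  have N0 : 0 <= u.1 ^+ 2 - 2 * rho * u.1 * u.2 + u.2 ^+ 2 by nra.
  (* The normal vector is the inverse correlation matrix applied to [u], up to the factor
     [1 - rho ^+ 2]: the half-plane is tangent at [a * u] to the level ellipse through that
     point. *)
  apply: (@pair_gt_le_halfplane i (u.1 - rho * u.2) (u.2 - rho * u.1)).
  + exact: ltW.
  + exact: ltW.
  + by rewrite addr_gt0.
  + by apply: addr_ge0; apply: mulr_ge0; exact: ltW.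
  + set N := u.1 ^+ 2 - 2 * rho * u.1 * u.2 + u.2 ^+ 2 in N0.
    have -> : combination_var rho (u.1 - rho * u.2) (u.2 - rho * u.1) =
              (1 - rho ^+ 2) * N by rewrite /combination_var /N; ring.
    have -> : (u.1 - rho * u.2) * (a * u.1) + (u.2 - rho * u.1) * (a * u.2) = a * N.
      by rewrite /N; ring.
    rewrite exprMn -mulrA ler_wpM2l ?sqr_ge0// mulrA expr2 ler_wpM2r//.
    by rewrite -ler_pdivlMr// /mahalanobis -/N ge_min lexx orbT.
Qed.

Lemma pair_gt_ge_rate u J v : 0 < u.1 -> 0 < u.2 -> u.2 <= u.1 ->
  rate_case rho u J ->
  J < v ->
  exists j, exists2 A : R, 0 < A & forall a, A <= a ->
    ((expR (- (a ^+ 2 * v) / 2))%:E <=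
     P (pair_gt 0%N j (a * u.1)%R (a * u.2)%R))%E.
Proof.
move=> u1 u2 u21 cases Jv.
have distinct : sqnorm2 u < v -> exists j, exists2 A : R, 0 < A & forall a, A <= a ->
    ((expR (- (a ^+ 2 * v) / 2))%:E <=
     P (pair_gt 0%N j (a * u.1)%R (a * u.2)%R))%E.
  by move=> uv; exists 1%N; exact: distinct_pair_gt_ge.
have lower := @quadrant_lower_bound _ _ _ P rho _ rho1 (mZ 0) (gZ 0).
case: cases => [[u2rho JE]|[_ JE]|[/andP[r0 r1] lt_u JE]]; last 2 first.
- by apply: distinct; rewrite -JE.
(* Whichever term of the minimum lies below [v] decides between two distinct vectors and a single
   one. *)
- move: Jv; rewrite JE gt_min => /orP[|Jv]; first exact: distinct.
  exists 0%N.
  have D0 : 0 < 1 - rho ^+ 2 by nra.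
  have b0 : 0 < u.1 - rho * u.2 by nra.
  have c0 : 0 < u.2 - rho * u.1 by lra.
  have q0 : 0 < mahalanobis rho u by rewrite /mahalanobis divr_gt0//; nra.
  have qE : mahalanobis rho u * (1 - rho ^+ 2) = u.1 ^+ 2 - 2 * rho * u.1 * u.2 + u.2 ^+ 2.
    by rewrite /mahalanobis divfK ?gt_eqF.
  set q := mahalanobis rho u in q0 qE Jv.
  pose s := Num.sqrt q.
  have s0 : 0 < s by rewrite sqrtr_gt0.
  have sE : s ^+ 2 = q by rewrite sqr_sqrtr// ltW.
  have sN0 : s != 0 by rewrite gt_eqF.
  have DN0 : 1 - rho ^+ 2 != 0 by rewrite gt_eqF.
  (* The same normal vector, scaled to unit variance. Given that this combination equals [s], the
     conditional mean is exactly [u], so both constraints hold with equality. *)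
  apply: (lower ((u.1 - rho * u.2) / ((1 - rho ^+ 2) * s))
                ((u.2 - rho * u.1) / ((1 - rho ^+ 2) * s)) s) => //.
  + transitivity ((u.1 ^+ 2 - 2 * rho * u.1 * u.2 + u.2 ^+ 2) /
                  ((1 - rho ^+ 2) * s ^+ 2)).
      by rewrite /combination_var; field; rewrite DN0 sN0.
    by rewrite sE -qE [_ * q]mulrC divff// mulf_neq0// gt_eqF.
  + by rewrite u1 (_ : _ * s = u.1) ?lexx//; field; rewrite DN0 sN0.
  + by rewrite u2 (_ : _ * s = u.2) ?lexx//; field; rewrite DN0 sN0.
  + by rewrite sE.
(* The combination is the first component; given that it equals [u.1], the second has mean
   [rho * u.1], at least [u.2] in this case. *)
- exists 0%N; apply: (lower 1 0 u.1) => //.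
  + by rewrite /combination_var; ring.
  + by rewrite u1 mulr0 addr0 mul1r lexx.
  + by rewrite u2 add0r mulr1.
  + by rewrite -JE.
Qed.

End extremes.

Theorem mainTheorem2 (R : realType) (d : measure_display)
    (T : measurableType d) (P : probability T R) (rho : R)
    (Z : nat -> {RV P >-> (R * R)%type}) (a : nat -> R) (u : R * R) :
  -1 <= rho <= 1 ->
  iid Z ->
  (forall i : nat, std_bivariate_gaussian P rho (Z i)) ->
  dominates_sqrt_log a ->
  0 < u.1 -> 0 < u.2 -> u.2 <= u.1 ->
  (((a n ^+ 2)^-1)%:E *
     lne (P [set w | vec_gt (Zbar (fun i => Z i : T -> R * R) n w)
                            (vec_scale (a n) u)]))%E @[n --> \oo]
    --> (- rate rho u)%E.
Proof.
move=> rho1 [indZ _] gZ da u1 u2 u21.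
have [J -> cases] := rate_cases rho1 u1 u2 u21.
apply: cvg_log_scale => //.
- near=> n.
  have n0 : (0 < n)%N by near: n; exact: nbhs_infty_gt.
  have a0 : 0 < a n by apply: da.1.
  apply: Zbar_gt_le => // i j /=.
  exact: (pair_gt_le_rate rho1 gZ indZ i j u1 u2 u21 cases a0).
- move=> v Jv.
  (* [j] and [A] depend on [v] but not on [n], so eventually [j < n] and [A <= a n]. *)
  have [j [A A0 HA]] := pair_gt_ge_rate rho1 gZ indZ u1 u2 u21 cases Jv.
  have aA := dominates_sqrt_log_cvgy A da.
  near=> n.
  have jn : (j < n)%N by near: n; exact: nbhs_infty_gt.
  have an : A <= a n by near: n.
  apply: le_trans (HA _ an) _.
  exact: (@Zbar_gt_ge _ _ _ _ Z n 0 j (vec_scale (a n) u) (leq_ltn_trans (leq0n j) jn) jn).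
Unshelve. all: by end_near.
Qed.
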